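(* Let $k \ge 3$, let $0 \le v < \lvert I_{k-2}\rvert$, and let $0 \le u \le 2^{k-1}-b_k$ be integers. Then $$\deg(B_{a_k+v})=\deg(B_{a_{k-2}+v})+1,$$ $$\deg(B_{b_k+u})=\deg(B_{a_{k-1}+u})+1,$$ $$\deg(B_{2^k-(b_k+u)})=\deg(B_{a_{k-1}+u})+1,$$ $$\deg(B_{c_k+v})=\deg(B_{2^{k-2}-(a_{k-2}+v)})+1.$$
   Context: The Stern polynomials $B_n(t)\in\mathbb{Z}[t]$ are defined by $B_0=0$, $B_1=1$, $B_{2n}=tB_n$, $B_{2n+1}=B_n+B_{n+1}$; $\deg$ denotes the degree in $t$. A BSD representation of an integer $n$ is a digit string $(b_{m-1}\cdots b_0)$ with $b_j\in\{1,0,-1\}$ and $n=\sum b_j2^j$. A non-adjacent form (NAF) is a BSD representation in which no two adjacent digits are both nonzero; it is reduced if its leading digit $b_{m-1}$ is nonzero. Every positive integer has exactly one reduced NAF; its length is the NAF-bitlength of $n$. $I_k$ denotes the set of positive integers of NAF-bitlength $k$; it is a set of consecutive integers (e.g. $I_1=\{1\}$, $I_2=\{2\}$, $I_3=\{3,4,5\}$, $I_4=\{6,\dots,10\}$), and for $k\ge 3$, $\lvert I_k\rvert=2\lvert I_{k-2}\rvert+\lvert I_{k-1}\rvert$. Write $a_k=\min I_k$ for $k\ge1$ and $a_0=0$ (equivalently $a_1=1,a_2=2$, $a_k=2^{k-2}+a_{k-2}$). For $k\ge 3$, $I_k$ is partitioned into consecutive subintervals $\mathcal{A}_k$ (the first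 $\lvert I_{k-2}\rvert$ elements), $\mathcal{B}_k$ (the next $\lvert I_{k-1}\rvert$ elements) and $\mathcal{C}_k$ (the last $\lvert I_{k-2}\rvert$ elements), with minima $a_k$, $b_k=a_k+\lvert I_{k-2}\rvert$ and $c_k=b_k+\lvert I_{k-1}\rvert=2^{k-1}+a_{k-2}$ respectively. *)

(* Defs.v *)
From HB Require Import structures.
From mathcomp Require Import all_boot all_order all_algebra.
From mathcomp Require Import finmap.
From mathcomp Require Import zify.

Set Implicit Arguments.
Unset Strict Implicit.
Unset Printing Implicit Defensive.

Import GRing.Theory.
Local Open Scope ring_scope.

(* The fuel argument only serves termination; the defining recurrences are
   the lemmas stern0, stern1, stern_double and stern_doubleS. *)
Fixpoint stern_rec (fuel n : nat) : {poly int} :=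
  if fuel is f.+1 then
    if n == 0%N then 0
    else if n == 1%N then 1
    else if odd n then stern_rec f n./2 + stern_rec f n./2.+1
    else 'X * stern_rec f n./2
  else 0.

Definition stern (n : nat) : {poly int} := stern_rec n n.

Lemma stern_rec_fuel f n : (n <= f)%N -> stern_rec f n = stern n.
Proof.
rewrite /stern.
suff H m1 m2 j : (j <= m1)%N -> (j <= m2)%N -> stern_rec m1 j = stern_rec m2 j.
  by move=> le_nf; apply: H.
elim: m1 m2 j => [|m1 IH] [|m2] j //=.
- by rewrite leqn0 => ->.
- by move=> _; rewrite leqn0 => ->.
move=> le1 le2; case: eqP => // j0; case: eqP => // j1.
by case: ifP => oj; rewrite !(IH m2) //; lia.
Qed.

Lemma stern0 : stern 0 = 0.
Proof. by []. Qed.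

Lemma stern1 : stern 1 = 1.
Proof. by []. Qed.

Lemma stern_step n : (1 < n)%N ->
  stern n = if odd n then stern n./2 + stern n./2.+1 else 'X * stern n./2.
Proof.
case: n => [|[|n]] // _.
have -> m : stern m.+2 = if odd m.+2
    then stern_rec m.+1 m.+2./2 + stern_rec m.+1 m.+2./2.+1
    else 'X * stern_rec m.+1 m.+2./2 by [].
by case: ifP => on; rewrite !stern_rec_fuel //; lia.
Qed.

Lemma stern_double n : stern (2 * n) = 'X * stern n.
Proof.
case: n => [|n]; first by rewrite muln0 stern0 mulr0.
rewrite stern_step; last by lia.
by rewrite mul2n odd_double doubleK.
Qed.

Lemma stern_doubleS n : stern (2 * n + 1) = stern n + stern n.+1.
Proof.
case: n => [|n]; first by rewrite add0r.
rewrite stern_step; last by lia.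
by rewrite addn1 mul2n oddS odd_double -uphalfE uphalf_double.
Qed.

(* Only meaningful for p != 0; the zero polynomial gets degree 0. *)
Definition deg (p : {poly int}) : nat := (size p).-1.

(* Digit strings are stored least significant digit first: b`_j is the
   coefficient of 2 ^ j, and the leading digit is the last item. *)
Definition bsd_digits : seq int := [:: 1; 0; -1].

Definition bsd_string (b : seq int) : bool := all (mem bsd_digits) b.

Definition bsd_value (b : seq int) : int := \sum_(j < size b) b`_j * 2 ^+ j.

Definition naf (b : seq int) : bool :=
  bsd_string b && sorted (fun x y => ~~ ((x != 0) && (y != 0))) b.

Definition reduced_naf (b : seq int) : bool := naf b && (last 0 b != 0).

Definition naf_bitlength (n k : nat) : Prop :=
  exists b : seq int, [/\ reduced_naf b, bsd_value b = n & size b = k].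

Definition ints_of_digits (k : nat) (b : k.-tuple (seq_sub bsd_digits)) :
  seq int := map val (tval b).

(* The set of positive integers of NAF-bitlength k, obtained as the positive
   values of the finitely many strings of k digits; see in_nafI. *)
Definition nafI (k : nat) : {fset nat} :=
  [fset absz (bsd_value (ints_of_digits b)) |
     b : k.-tuple (seq_sub bsd_digits)
     & reduced_naf (ints_of_digits b) && (0 < bsd_value (ints_of_digits b))]%fset.

Lemma in_nafI (k n : nat) : n \in nafI k <-> (0 < n)%N /\ naf_bitlength n k.
Proof.
split.
  case/imfsetP => /= b; rewrite inE => /andP[rb v0] ->.
  split; first by lia.
  exists (ints_of_digits b); split=> //; first by lia.
  by rewrite size_map size_tuple.
case=> n0 [b [rb vb sb]].
have /andP[/andP[ab _] _] := rb.
have [t tE] : exists t : seq (seq_sub bsd_digits), map val t = b.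
  elim: b ab {rb sb vb} => [|x b IH] /=; first by exists [::].
  by case/andP=> xd /IH[t <-]; exists (SeqSub xd :: t).
have st : size t == k by rewrite -sb -tE size_map.
have bE : ints_of_digits (Tuple st) = b by [].
by apply/imfsetP; exists (Tuple st); rewrite /= ?inE bE vb // rb.
Qed.

(* Least element of a finite set of naturals, 0 if the set is empty. *)
Definition fset_min (A : {fset nat}) : nat := head 0%N (sort leq A).

Lemma fset_minP (A : {fset nat}) (n : nat) :
  n \in A -> fset_min A \in A /\ (fset_min A <= n)%N.
Proof.
rewrite /fset_min => nA; have := sort_sorted leq_total A.
have : n \in sort leq A by rewrite mem_sort.
have : forall x, x \in sort leq A -> x \in A by move=> x; rewrite mem_sort.
case: (sort leq A) => [|m s] //= sA ns /(order_path_min leq_trans)/allP ms.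
split; first by apply: sA; rewrite inE eqxx.
by move: ns; rewrite inE => /predU1P[->|/ms].
Qed.

Definition a_ (k : nat) : nat := if k is 0 then 0%N else fset_min (nafI k).

Definition b_ (k : nat) : nat := (a_ k + #|` nafI (k - 2)|)%N.

Definition c_ (k : nat) : nat := (b_ k + #|` nafI (k - 1)|)%N.

(* Main.v *)
(** Since the Stern polynomials have nonnegative coefficients, their degrees
    satisfy [d (2n) = d n + 1] and [d (2n+1) = max (d n) (d (n+1))].
    The integers of NAF-bitlength [k] are those with
    [2 ^ k < 3 n < 2 ^ (k+1)], which makes [a_ k], [b_ k] and [c_ k] explicit;
    all four identities then become instances of
    [d (2 ^ j + m) = d m + 1 = d (3 * 2 ^ j - m)] for [2 ^ j <= 3 m <= 3 * 2 ^ j],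
    proved by induction on [j] through the recurrence for [d].  The induction
    leaves the range only at [p = (2 ^ j - 1) / 3], where [d p <= d (p+1)]
    suffices. *)
Require Import Defs.
From mathcomp Require Import all_boot all_order all_algebra.
From mathcomp Require Import finmap.
From mathcomp Require Import zify.

Import Order.TTheory GRing.Theory Num.Theory.

(** * Degree recurrences for the Stern polynomials *)

Section SternDegree.
Local Open Scope ring_scope.

Lemma stern_ge0 n i : 0 <= (stern n)`_i.
Proof.
have [m] := ubnP n; elim: m n i => // m IH n i le_nm.
case: (ltnP 1 n) => [n1|]; last first.
  by case: n {le_nm} => [|[|n]] // _; rewrite ?stern0 ?stern1 ?coef0 // coef1 ler0n.
rewrite stern_step //; case: ifP => on.
  by rewrite coefD addr_ge0 // IH //; lia.
by rewrite coefXM; case: ifP => // _; apply: IH; lia.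
Qed.

(** No cancellation can occur: the positive leading coefficient of the longer summand only grows. *)
Lemma size_addp_ge0 (p q : {poly int}) :
  (forall i, 0 <= p`_i) -> (forall i, 0 <= q`_i) ->
  size (p + q) = maxn (size p) (size q).
Proof.
wlog le_pq : p q / (size p <= size q)%N => [H p0 q0|p0 q0].
  case/orP: (leq_total (size p) (size q)) => le; first exact: H.
  by rewrite addrC maxnC; apply: H.
rewrite (maxn_idPr le_pq); apply/eqP; rewrite eqn_leq.
rewrite (leq_trans (size_polyD p q)) ?geq_max ?le_pq //=.
have [->|q_neq0] := eqVneq q 0; first by rewrite size_poly0.
have: 0 < lead_coef q by rewrite lt_def lead_coef_eq0 q_neq0 q0.
rewrite lead_coefE => lq; rewrite -(prednK (n := size q)) ?size_poly_gt0 //.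
rewrite ltnNge; apply/negP => /leq_sizeP/(_ _ (leqnn _)); rewrite coefD => /eqP.
by rewrite paddr_eq0 // (gt_eqF lq) andbF.
Qed.

Lemma size_stern_doubleS n :
  size (stern (2 * n + 1)) = maxn (size (stern n)) (size (stern n.+1)).
Proof. by rewrite stern_doubleS size_addp_ge0 //; apply: stern_ge0. Qed.

Lemma size_stern_gt0 n : (0 < n)%N -> (0 < size (stern n))%N.
Proof.
have [m] := ubnP n; elim: m n => // m IH n le_nm n0.
have [on|en] := boolP (odd n).
  have [->|n1] := eqVneq n 1%N; first by rewrite stern1 size_poly1.
  have -> : n = (2 * n./2 + 1)%N by lia.
  by rewrite size_stern_doubleS leq_max IH //; lia.
have -> : n = (2 * n./2)%N by lia.
rewrite stern_double size_poly_gt0 mulf_neq0 ?polyX_eq0 //.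
by rewrite -size_poly_gt0 IH //; lia.
Qed.

Lemma deg_stern_double n :
  (0 < n)%N -> deg (stern (2 * n)) = (deg (stern n)).+1.
Proof.
move=> /size_stern_gt0 n0; rewrite /deg stern_double mulrC size_mulX.
  by rewrite /= prednK.
by rewrite -size_poly_gt0.
Qed.

Lemma deg_stern_doubleS n :
  deg (stern (2 * n + 1)) = maxn (deg (stern n)) (deg (stern n.+1)).
Proof. by rewrite /deg size_stern_doubleS; lia. Qed.

End SternDegree.

(** * Shift and reflection of the argument *)

Lemma deg_stern_third j p :
  3 * p + 1 = 2 ^ j -> deg (stern p) <= deg (stern p.+1).
Proof.
have [m] := ubnP j; elim: m j p => // m IH [|[|j]] p le_jm pE.
- have -> : p = 0 by lia.
  by rewrite stern0 /deg size_poly0.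
- by lia.
move: pE; rewrite !expnS => pE.
(* [3 * p + 1] is divisible by 4, so [p] is 1 modulo 4. Then [d p = max (d (2q)) (d (2q+1))], while
   [d (p+1) = d (2q+1) + 1] is at least [d q + 1]. *)
have [q qE] : exists q, p = 2 * (2 * q) + 1 by exists (p %/ 4); lia.
have {}IH : deg (stern q) <= deg (stern q.+1) by apply: (IH j); lia.
have -> : p.+1 = 2 * (2 * q + 1) by lia.
rewrite qE deg_stern_double ?deg_stern_doubleS; last by lia.
have -> : (2 * q).+1 = 2 * q + 1 by lia.
(* The doubling rule fails at 0, whose degree is 0 by convention. *)
rewrite deg_stern_doubleS; case: q {qE pE} IH => [|q] IH; first by rewrite muln0; lia.
by rewrite deg_stern_double //; lia.
Qed.

Lemma deg_stern_shift j m : 2 ^ j <= 3 * m -> m <= 2 ^ j ->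
  deg (stern (2 ^ j + m)) = (deg (stern m)).+1 /\
  deg (stern (3 * 2 ^ j - m)) = (deg (stern m)).+1.
Proof.
elim: j m => [|j IH] m lo hi.
  have -> : m = 1 by lia.
  by split; apply: (deg_stern_double 1).
move: lo hi; rewrite !expnS; set N := 2 ^ j in IH * => lo hi.
have [om|em] := boolP (odd m); last first.
  have [p pE] : exists p, m = 2 * p by exists m./2; lia.
  have [||IH1 IH2] := IH p; try lia.
  have -> : 2 * N + m = 2 * (N + p) by lia.
  have -> : 3 * (2 * N) - m = 2 * (3 * N - p) by lia.
  by rewrite pE !deg_stern_double ?IH1 ?IH2 //; lia.
have [p pE] : exists p, m = 2 * p + 1 by exists m./2; lia.
have [||S1 S2] := IH p.+1; try lia.
have -> : 2 * N + m = 2 * (N + p) + 1 by lia.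
have -> : 3 * (2 * N) - m = 2 * (3 * N - p.+1) + 1 by lia.
rewrite pE !deg_stern_doubleS -addnS S1 S2.
have -> : (3 * N - p.+1).+1 = 3 * N - p by lia.
case: (leqP N (3 * p)) => ltN.
  by have [||-> ->] := IH p; lia.
(* [2 * N <= 6 * p + 3] and parity give [N <= 3 * p + 1]. *)
have NE : 3 * p + 1 = N by lia.
have le_p := deg_stern_third _ _ NE.
(* With [N = 3 p + 1], the two out-of-range arguments are [4 p + 1] and
   [8 p + 3], whose degrees the recurrence bounds directly. *)
have -> : N + p = 2 * (2 * p) + 1 by lia.
have -> : 3 * N - p = 2 * (2 * (2 * p) + 1) + 1 by lia.
have E4 : (2 * (2 * p) + 1).+1 = 2 * (2 * p + 1) by lia.
have E2 : (2 * p).+1 = 2 * p + 1 by lia.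
rewrite (deg_stern_doubleS (2 * (2 * p) + 1)) E4.
rewrite deg_stern_double ?deg_stern_doubleS ?E2 ?deg_stern_doubleS; last by lia.
case: p {lo hi pE S1 S2 ltN E4 E2 om NE} le_p => [|p] le_p.
   by rewrite muln0; lia.
by rewrite deg_stern_double //; lia.
Qed.

(** * Non-adjacent forms and the intervals of given NAF-bitlength *)

Section NafInterval.
Local Open Scope ring_scope.

Lemma bsd_value_cons x b : bsd_value (x :: b) = x + 2 * bsd_value b.
Proof.
rewrite /bsd_value /= big_ord_recl /= expr0 mulr1; congr (_ + _).
rewrite mulr_sumr; apply: eq_bigr => i _.
by rewrite /= exprS mulrCA.
Qed.

Lemma naf_cons0 b : naf (0 :: b) = naf b.
Proof. by rewrite /naf /=; case: b => //= y b; rewrite eqxx. Qed.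

Lemma naf_cons_neq0 x y b :
  x != 0 -> naf (x :: y :: b) -> y = 0 /\ naf b.
Proof.
rewrite /naf /= => -> /andP[/and3P[_ _ ->]] /andP[].
by rewrite /= negbK => /eqP -> /path_sorted ->.
Qed.

Lemma naf_cons1 (x : int) b : x \in [:: 1; -1] -> naf b -> naf (x :: 0 :: b).
Proof.
rewrite !inE => xE /andP[bb sb]; rewrite /naf /=.
rewrite andbF bb /=; apply/andP; split.
  by rewrite andbT !inE; case/orP: xE => ->; rewrite ?orbT.
by case: b sb {bb} => //= y b; rewrite eqxx.
Qed.

Lemma naf_head x b : naf (x :: b) -> [\/ x = 0, x = 1 | x = -1].
Proof.
case/andP => /= /andP[]; rewrite !inE => /or3P[]/eqP-> _ _.
- exact: Or32.
- exact: Or31.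
- exact: Or33.
Qed.

(** A nonzero lowest digit is followed by 0, so the value is [x + 4 w] with [w] two digits shorter.
    By integrality [3 * |w|] is at most the bound minus 1; multiplying by 4 leaves room for the
    extra 3. *)
Lemma naf_value_lt b : naf b -> 3 * `|bsd_value b| < 2 ^+ (size b).+1.
Proof.
have [m] := ubnP (size b); elim: m b => // m IH [|x b] le_bm nb.
  by rewrite /bsd_value big_ord0.
have [x0|x0] := eqVneq x 0.
  have := nb; rewrite x0 naf_cons0 => /IH; rewrite bsd_value_cons /= !exprS.
  by move: le_bm => /= le_bm /(_ le_bm); lia.
have xE : `|x| = 1 by have [] := naf_head _ _ nb => xE; rewrite xE in x0 *.
case: b => [|y b] in le_bm nb *.
  by rewrite bsd_value_cons /bsd_value big_ord0 /= !exprS expr0; lia.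
have [-> /IH] := naf_cons_neq0 _ _ _ x0 nb.
rewrite !bsd_value_cons /= !exprS => H.
by have {}H := H ltac:(by move: le_bm => /=; lia); lia.
Qed.

Lemma reduced_naf_value_gt b :
  reduced_naf b -> 2 ^+ (size b) < 3 * `|bsd_value b|.
Proof.
have [m] := ubnP (size b); elim: m b => // m IH [|x b] le_bm /andP[nb lb].
  by move: lb; rewrite eqxx.
have [x0|x0] := eqVneq x 0.
  have rb : reduced_naf b.
    by move: nb lb; rewrite /reduced_naf x0 naf_cons0 => -> /=.
  have := IH b le_bm rb.
  by rewrite x0 bsd_value_cons /= !exprS; lia.
have xE : `|x| = 1 by have [] := naf_head _ _ nb => xE; rewrite xE in x0 *.
case: b => [|y b] in le_bm nb lb *.
  by rewrite bsd_value_cons /bsd_value big_ord0 /= !exprS expr0; lia.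
have [y0 nb'] := naf_cons_neq0 _ _ _ x0 nb.
have rb : reduced_naf b by rewrite /reduced_naf nb' /=; move: lb; rewrite y0.
have := IH b ltac:(by move: le_bm => /=; lia) rb.
by rewrite y0 !bsd_value_cons /= !exprS; lia.
Qed.

End NafInterval.

Lemma expn2_mod3 k : 2 ^ k %% 3 != 0.
Proof. by elim: k => // k IH; rewrite expnS; lia. Qed.

(** Digits are chosen from the low end: 0 for even [n]; for odd [n], the sign [x] making [n - x]
    divisible by 4, then a 0. *)
Lemma reduced_naf_exists k n : 0 < k -> 2 ^ k <= 3 * n -> 3 * n < 2 ^ k.+1 ->
  exists b, [/\ reduced_naf b, bsd_value b = n & size b = k].
Proof.
have [m] := ubnP k; elim: m k n => // m IH k n le_km k0 lo hi.
have [on|en] := boolP (odd n); last first.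
  case: k => [//|[|k]] in le_km k0 lo hi *.
    by move: lo hi; rewrite !expnS expn0; lia.
  have [p pE] : exists p, n = 2 * p by exists n./2; lia.
  have [||||b [/andP[nb lb] vb sb]] := IH k.+1 p.
  - by lia.
  - by [].
  - by move: lo; rewrite !expnS; lia.
  - by move: hi; rewrite !expnS; lia.
  exists (0%R :: b); split; last by rewrite /= sb.
    by rewrite /reduced_naf naf_cons0 nb.
  by rewrite bsd_value_cons vb; lia.
case: k => [//|[|[|k]]] in le_km k0 lo hi *.
- have -> : n = 1 by move: lo hi; rewrite !expnS expn0; lia.
  exists [:: 1%R]; split=> //.
  by rewrite bsd_value_cons /bsd_value big_ord0.
- by move: lo hi; rewrite !expnS expn0; lia.
(* Rounding up with [x = -1] could give [3 * p = 2 ^ k.+2]; divisibility by 3 excludes this. *)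
have N3 := expn2_mod3 k.
have [p [x [pE xE]]] : exists p x, (n%:Z = x + 4 * p%:Z)%R /\ x \in [:: 1; -1]%R.
  have [r1|r3] := eqVneq (n %% 4) 1.
    by exists (n %/ 4), 1%R; split=> //; lia.
  by exists (n.+1 %/ 4), (-1)%R; split=> //; lia.
have x1 : (`|x| = 1)%R by move: xE; rewrite !inE => /orP[]/eqP->.
have [||||b [/andP[nb lb] vb sb]] := IH k.+1 p.
- by lia.
- by [].
- by move: lo hi; rewrite !expnS; lia.
- by move: lo hi; rewrite !expnS; lia.
exists [:: x, 0%R & b]; split; last by rewrite /= sb.
  by rewrite /reduced_naf naf_cons1.
by rewrite !bsd_value_cons vb; lia.
Qed.

Lemma mem_nafI k n : 0 < k ->
  (n \in nafI k) = (2 ^ k <= 3 * n) && (3 * n < 2 ^ k.+1).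
Proof.
move=> k0; apply/idP/idP => [/in_nafI[n0 [b [rb vb sb]]]|/andP[lo hi]].
  have /andP[nb _] := rb.
  have := naf_value_lt _ nb; have := reduced_naf_value_gt _ rb.
  have E i : (2 ^+ i = (2 ^ i)%N :> int)%R by rewrite -natz natrX.
  by rewrite vb sb !E; lia.
apply/in_nafI; split; last exact: reduced_naf_exists.
by have := expn_gt0 2 k; lia.
Qed.

(** The quotient is the ceiling of [2 ^ k / 3]. *)
Lemma a_E k : 0 < k -> a_ k = (2 ^ k + 2) %/ 3.
Proof.
case: k => // k _; rewrite /a_.
have N3 := expn2_mod3 k.+1.
have: (2 ^ k.+1 + 2) %/ 3 \in nafI k.+1.
  rewrite mem_nafI // (expnS 2 k.+1); have := expn_gt0 2 k.
  by rewrite expnS in N3 *; lia.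
by case/fset_minP; rewrite mem_nafI //; lia.
Qed.

Lemma card_nafI k : 0 < k ->
  #|` nafI k| = (2 ^ k.+1 + 2) %/ 3 - (2 ^ k + 2) %/ 3.
Proof.
move=> k0; have N3 := expn2_mod3 k.
rewrite -[RHS](size_iota ((2 ^ k + 2) %/ 3)).
apply: perm_size; apply: uniq_perm => [||n]; rewrite ?fset_uniq ?iota_uniq //.
by rewrite mem_iota mem_nafI // expnS; lia.
Qed.

Theorem mainTheorem2 (k v u : nat) (hk : 3 <= k)
    (hv : v < #|` nafI (k - 2)|) (hu : b_ k + u <= 2 ^ (k - 1)) :
  [/\ deg (stern (a_ k + v)) = deg (stern (a_ (k - 2) + v)) + 1,
      deg (stern (b_ k + u)) = deg (stern (a_ (k - 1) + u)) + 1,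
      deg (stern (2 ^ k - (b_ k + u))) = deg (stern (a_ (k - 1) + u)) + 1 &
      deg (stern (c_ k + v)) =
        deg (stern (2 ^ (k - 2) - (a_ (k - 2) + v))) + 1].
Proof.
have [j jk] : exists j, k = j.+3 by exists (k - 3); lia.
subst k; move: hv hu; rewrite /c_ /b_.
have -> : j.+3 - 2 = j.+1 by lia.
have -> : j.+3 - 1 = j.+2 by lia.
rewrite !a_E // !card_nafI // !(expnS 2 j.+1, expnS 2 j.+2).
have N3 := expn2_mod3 j.+1; have sh := deg_stern_shift j.+1.
(* With [N = 2 ^ (k-2)], the formulas give [a_k = N + a_(k-2)], [b_k = N + a_(k-1)] and
   [c_k = 2N + a_(k-2)]. The last two identities are reflections [3N - m], with [m = a_(k-1) + u]
   and [m = N - (a_(k-2) + v)]. *)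
set N := 2 ^ j.+1 in N3 sh * => hv hu; rewrite !addn1.
split.
- rewrite -(sh _ _ _).1; first congr (deg (stern _)); lia.
- rewrite -(sh _ _ _).1; first congr (deg (stern _)); lia.
- rewrite -(sh _ _ _).2; first congr (deg (stern _)); lia.
- rewrite -(sh _ _ _).2; first congr (deg (stern _)); lia.
Qed.
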